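(* Let $\alpha\in[0,1)$, $\psi_2\in(0,\infty)$, $\lambda>0$, $F_1>0$, $F_\star,\tau\ge0$ with $F_\star^2+\tau^2>0$, and $\rho=F_1^2/(F_\star^2+\tau^2)$. Let $\mathcal E^\infty_{R_2}$ and $\mathcal S^\infty_{R_2}$ be the explicit functions of $(\mu_0,\mu_1,\mu_2)$ given in the context, and let $\mathcal U_{R_2}$ be the set of triples $(\mu_0,\mu_1,\mu_2)$ minimizing $(1-\alpha)\mathcal E^\infty_{R_2}+\alpha\,\mathcal S^\infty_{R_2}$. Then $$\mathcal U_{R_2}=\big\{(\mu_0,\mu_1,\mu_2):\ \mu_1^2(-1+2\psi_2-x)(-1+x)=-2(\mu_\star^2+\lambda\psi_2)(1+x)\big\},$$ where $x$ is the unique solution of $p(x)=0$ in the range $x\in(-1,\min\{1,-1+2\psi_2\})$, with $p(x)=p_0+p_1x+p_2x^2+p_3x^3+p_4x^4$ and $$p_0=8\psi_2\rho^{-1}+\alpha+4\psi_2(-1+2\psi_2)(-1+2\alpha),\qquad p_1=8\psi_2\rho^{-1}+4\big((1-4\psi_2)\alpha+2\psi_2^2\big),$$ $$p_2=-2\big(-3\alpha+\psi_2(2+4\alpha)\big),\qquad p_3=4\alpha,\qquad p_4=\alpha .$$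
   Context: Triples $(\mu_0,\mu_1,\mu_2)$ range over real triples with $\mu_\star^2:=\mu_2-\mu_0^2-\mu_1^2\ge0$ (they are the moments $\mathbb E\sigma(Z)$, $\mathbb EZ\sigma(Z)$, $\mathbb E\sigma(Z)^2$, $Z\sim\mathcal N(0,1)$, of an activation function). Put $\zeta^2=\mu_1^2/\mu_\star^2$, $\overline\lambda=\lambda/\mu_\star^2$ and $$\omega_2=-\frac{\sqrt{(\psi_2\zeta^2-\zeta^2-\overline\lambda\psi_2-1)^2+4\psi_2\zeta^2(\overline\lambda\psi_2+1)}+\psi_2\zeta^2-\zeta^2-\overline\lambda\psi_2-1}{2(\overline\lambda\psi_2+1)},$$ extended by continuity to $\mu_\star=0$ (multiply numerator and denominator by $\mu_\star^2$). The asymptotic test error and sensitivity in the highly overparameterized regime are $$\mathcal E^\infty_{R_2}=F_1^2\,\frac{\psi_2\omega_2-\psi_2}{Q}+(\tau^2+F_\star^2)\,\frac{\omega_2^3-\omega_2^2}{Q}+F_\star^2,\qquad Q=(\psi_2-1)\omega_2^3+(1-3\psi_2)\omega_2^2+3\psi_2\omega_2-\psi_2,$$ $$\mathcal S^\infty_{R_2}=\frac{\omega_2^2\big((F_\star^2+\tau^2)(-1+\omega_2)+F_1^2(-1-\psi_2+\omega_2(-1+\psi_2))\big)}{(-1+\omega_2)\big(\psi_2-2\omega_2\psi_2+\omega_2^2(-1+\psi_2)\big)} .$$ *)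

(* Defs.v *)
From HB Require Import structures.
From mathcomp Require Import all_boot all_order all_algebra.
From mathcomp Require Import classical_sets reals.
From mathcomp Require Import ring.
Set Implicit Arguments.
Unset Strict Implicit.
Unset Printing Implicit Defensive.
Import Order.TTheory GRing.Theory Num.Theory.
Local Open Scope ring_scope.

(* A triple of type R * R * R is ((mu0, mu1), mu2). *)

Definition mustar2 (R : realType) (m : R * R * R) : R :=
  let: (mu0, mu1, mu2) := m in mu2 - mu0 ^+ 2 - mu1 ^+ 2.

Definition triples (R : realType) : set (R * R * R) :=
  [set m | 0 <= mustar2 m].

(* The formula for omega_2 in terms of zeta2 = mu1^2 / mustar^2 and
   lbar = lambda / mustar^2; meaningful when mustar^2 > 0. *)
Definition omega2_generic (R : realType) (psi2 zeta2 lbar : R) : R :=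
  - ((Num.sqrt ((psi2 * zeta2 - zeta2 - lbar * psi2 - 1) ^+ 2
                + 4 * psi2 * zeta2 * (lbar * psi2 + 1))
      + psi2 * zeta2 - zeta2 - lbar * psi2 - 1)
     / (2 * (lbar * psi2 + 1))).

(* The extension by continuity of omega2_generic to mustar = 0: numerator and
   denominator are multiplied by mustar^2 (see omega2E).  For lambda, psi2 > 0
   the denominator is positive on all of [triples R]. *)
Definition omega2 (R : realType) (psi2 lambda : R) (m : R * R * R) : R :=
  let: (_, mu1, _) := m in
  let s := mustar2 m in
  - ((Num.sqrt ((psi2 * mu1 ^+ 2 - mu1 ^+ 2 - lambda * psi2 - s) ^+ 2
                + 4 * psi2 * mu1 ^+ 2 * (lambda * psi2 + s))
      + psi2 * mu1 ^+ 2 - mu1 ^+ 2 - lambda * psi2 - s)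
     / (2 * (lambda * psi2 + s))).

Lemma omega2E (R : realType) (psi2 lambda mu0 mu1 mu2 : R) :
  let s := mustar2 (mu0, mu1, mu2) in 0 < s ->
  omega2 psi2 lambda (mu0, mu1, mu2)
  = omega2_generic psi2 (mu1 ^+ 2 / s) (lambda / s).
Proof.
move=> s s_gt0; rewrite /omega2 /omega2_generic -/s.
have s0 : s != 0 by rewrite gt_eqF.
set D := (X in Num.sqrt X); set D' := (X in _ = - ((Num.sqrt X + _ - _ - _ - _) / _)).
have -> : D = s ^+ 2 * D' by rewrite /D /D'; field.
rewrite sqrtrM ?sqr_ge0// sqrtr_sqr gtr0_norm//.
move: (Num.sqrt D') => q.
have -> : lambda * psi2 + s = s * (lambda / s * psi2 + 1) by field.
have -> : s * q + psi2 * mu1 ^+ 2 - mu1 ^+ 2 - lambda * psi2 - s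
  = s * (q + psi2 * (mu1 ^+ 2 / s) - mu1 ^+ 2 / s - lambda / s * psi2 - 1).
  by field.
by rewrite (mulrCA 2 s) -mulf_div divff// mul1r.
Qed.

Definition test_error (R : realType) (psi2 lambda F1 Fs tau : R)
    (m : R * R * R) : R :=
  let w := omega2 psi2 lambda m in
  let Q := (psi2 - 1) * w ^+ 3 + (1 - 3 * psi2) * w ^+ 2 + 3 * psi2 * w
           - psi2 in
  F1 ^+ 2 * ((psi2 * w - psi2) / Q)
  + (tau ^+ 2 + Fs ^+ 2) * ((w ^+ 3 - w ^+ 2) / Q) + Fs ^+ 2.

Definition sensitivity (R : realType) (psi2 lambda F1 Fs tau : R)
    (m : R * R * R) : R :=
  let w := omega2 psi2 lambda m in
  w ^+ 2 * ((Fs ^+ 2 + tau ^+ 2) * (-1 + w)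
            + F1 ^+ 2 * (-1 - psi2 + w * (-1 + psi2)))
  / ((-1 + w) * (psi2 - 2 * w * psi2 + w ^+ 2 * (-1 + psi2))).

Definition objective (R : realType) (alpha psi2 lambda F1 Fs tau : R)
    (m : R * R * R) : R :=
  (1 - alpha) * test_error psi2 lambda F1 Fs tau m
  + alpha * sensitivity psi2 lambda F1 Fs tau m.

Definition minimizers (R : realType) (alpha psi2 lambda F1 Fs tau : R)
  : set (R * R * R) :=
  [set m | triples m /\ forall m', triples m' ->
     objective alpha psi2 lambda F1 Fs tau m
     <= objective alpha psi2 lambda F1 Fs tau m'].

Definition quartic (R : realType) (alpha psi2 rho x : R) : R :=
  let p0 := 8 * psi2 * rho^-1 + alpha
            + 4 * psi2 * (-1 + 2 * psi2) * (-1 + 2 * alpha) in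
  let p1 := 8 * psi2 * rho^-1
            + 4 * ((1 - 4 * psi2) * alpha + 2 * psi2 ^+ 2) in
  let p2 := - (2 * (- (3 * alpha) + psi2 * (2 + 4 * alpha))) in
  let p3 := 4 * alpha in
  let p4 := alpha in
  p0 + p1 * x + p2 * x ^+ 2 + p3 * x ^+ 3 + p4 * x ^+ 4.

(* Main.v *)
Require Import Defs.
From HB Require Import structures.
From mathcomp Require Import all_boot all_order all_algebra.
From mathcomp Require Import classical_sets reals.
From mathcomp Require Import ring lra.
Set Implicit Arguments.
Unset Strict Implicit.
Unset Printing Implicit Defensive.
Import Order.TTheory GRing.Theory Num.Theory.
Local Open Scope ring_scope.

(* Substitute omega_2 = - y / (2 - y), where y = 1 + x: as the triple varies, y
   takes every value in [0, min 2 (2 psi2)), and the objective becomes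
   (Fs^2 + tau^2) G(y) + const with G = N / D rational, D(y) = 4 psi2 - y^2.
   The numerator N' D - N D' of G' is rho times the quartic.  If v is a root of
   the quartic, then N(y) D(v) - N(v) D(y) is a cubic in y with a double root at
   v, and the remaining linear factor is positive on the whole range.  Hence
   every root is the strict global minimizer of G; this gives both the
   uniqueness of the root and the description of the minimizers. *)

(** * The one-variable problem: a root of the quartic is a strict minimizer *)

Section ReducedObjective.
Variables (R : realFieldType) (alpha psi2 rho : R).

Definition red_num (y : R) : R :=
  (1 - alpha) * rho * psi2 * (2 - y) ^+ 2
  + y ^+ 2 * (1 + alpha * rho * (psi2 + 1 - y)).

Definition red_den (y : R) : R := 4 * psi2 - y ^+ 2.

Definition red_obj (y : R) : R := red_num y / red_den y.

(** The product [(2 - y) * (2 * psi2 - y)] is kept apart: it is positive on the open range and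
    vanishes at its right end. *)
Definition red_quartic (y : R) : R :=
  8 * psi2 * rho^-1 * y - 4 * psi2 * (1 - alpha) * ((2 - y) * (2 * psi2 - y))
  + alpha * (8 * psi2 * (psi2 + 1) * y - 12 * psi2 * y ^+ 2 + y ^+ 4).

Lemma red_den_gt0 (y : R) : 0 <= y -> y < 2 -> y < 2 * psi2 -> 0 < red_den y.
Proof. by rewrite /red_den => *; nra. Qed.

(** This bound makes the coefficient of [alpha] nonnegative when the positivity of the linear factor
    in [red_obj_min] is proved. *)
Lemma red_cofactor_ge0 (v y : R) : 0 <= v -> v < 2 -> v < 2 * psi2 ->
  y <= 2 -> y <= 2 * psi2 ->
  y * ((2 - v) * (2 * psi2 - v))
  <= 4 * psi2 * (psi2 + 1) - 8 * psi2 * v + (psi2 + 1) * v ^+ 2.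
Proof.
move=> v0 v2 vp y2 yp.
pose d := 2 - v; pose e := 2 * psi2 - v.
have d0 : 0 < d by rewrite subr_gt0.
have e0 : 0 < e by rewrite subr_gt0.
have de0 : 0 < d * e by rewrite mulr_gt0.
have -> : 4 * psi2 * (psi2 + 1) - 8 * psi2 * v + (psi2 + 1) * v ^+ 2
  = v * (d ^+ 2 + e ^+ 2) / 2 + (d + e) * (d * e) / 2 by rewrite /d /e; field.
(* The left side is largest at [y = min 2 (2 * psi2)], which is [v + min d e]. *)
have [de|ed] := leP d e.
  apply: (@le_trans _ _ ((v + d) * (d * e))).
    by rewrite ler_pM2r// /d; lra.
  rewrite -subr_ge0.
  have -> : v * (d ^+ 2 + e ^+ 2) / 2 + (d + e) * (d * e) / 2 - (v + d) * (d * e)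
    = v * (d - e) ^+ 2 / 2 + d * e * (e - d) / 2 by field.
  by rewrite addr_ge0// divr_ge0// mulr_ge0// ?sqr_ge0 ?subr_ge0// ltW.
apply: (@le_trans _ _ ((v + e) * (d * e))).
  by rewrite ler_pM2r// /e; lra.
rewrite -subr_ge0.
have -> : v * (d ^+ 2 + e ^+ 2) / 2 + (d + e) * (d * e) / 2 - (v + e) * (d * e)
  = v * (d - e) ^+ 2 / 2 + d * e * (d - e) / 2 by field.
by rewrite addr_ge0// divr_ge0// mulr_ge0// ?sqr_ge0 ?subr_ge0// ltW.
Qed.

Hypotheses (alpha_ge0 : 0 <= alpha) (psi2_gt0 : 0 < psi2) (rho_gt0 : 0 < rho).

Lemma red_obj_min (v y : R) : 0 < v -> v < 2 -> v < 2 * psi2 ->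
  red_quartic v = 0 -> 0 <= y -> y < 2 -> y < 2 * psi2 -> y != v ->
  red_obj v < red_obj y.
Proof.
move=> v0 v2 vp Hv y0 y2 yp yv.
have rho0 : rho != 0 by rewrite gt_eqF.
have Dv := red_den_gt0 (ltW v0) v2 vp.
have Dy := red_den_gt0 y0 y2 yp.
rewrite /red_obj ltr_pdivrMr// mulrAC ltr_pdivlMr// -subr_gt0.
(* Linear factor left after the expansion around [v], whose first-order coefficient is
   [rho * red_quartic v]. *)
pose L := red_den v * ((1 - alpha) * rho * psi2 + 1 + alpha * rho * (psi2 + 1)
  - 3 * alpha * rho * v - alpha * rho * (y - v)) + red_num v.
have -> : red_num y * red_den v - red_num v * red_den y
  = (y - v) * rho * red_quartic v + (y - v) ^+ 2 * L.
  by rewrite /L /red_num /red_den /red_quartic; field.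
rewrite Hv mulr0 add0r mulr_gt0 ?exprn_even_gt0 ?subr_eq0//.
(* Since D'(v) = -2v, stationarity turns 2v N(v) into -N'(v) D(v), so that D(v) factors out of 2v
   L. *)
pose B := 4 * psi2 * (1 - alpha) - alpha * v ^+ 2 - 2 * alpha * y * v.
have LB : 2 * v * L = rho * red_den v * B + rho * red_quartic v.
  by rewrite /L /B /red_num /red_den /red_quartic; field.
have P0 : 0 < (2 - v) * (2 * psi2 - v) by rewrite mulr_gt0 ?subr_gt0.
have B0 : 0 < B.
  rewrite -(pmulr_rgt0 _ P0).
  (* The root equation trades the term in [1 - alpha] for terms in [1 / rho] and [alpha]; the former
     gives strictness. *)
  have -> : (2 - v) * (2 * psi2 - v) * B
    = 8 * psi2 * v / rho
      + 2 * alpha * v * (4 * psi2 * (psi2 + 1) - 8 * psi2 * v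
          + (psi2 + 1) * v ^+ 2 - y * ((2 - v) * (2 * psi2 - v)))
      - red_quartic v.
    by rewrite /B /red_quartic; field.
  rewrite Hv subr0 ltr_pwDl ?divr_gt0 ?mulr_gt0//.
  by rewrite !mulr_ge0 ?(ltW v0)// subr_ge0 red_cofactor_ge0// ltW.
have v20 : 0 < 2 * v by rewrite mulr_gt0.
by rewrite -(pmulr_rgt0 _ v20) LB Hv mulr0 addr0 !mulr_gt0.
Qed.

End ReducedObjective.

(** * The quartic: change of variable and existence of a root *)

Lemma quartic_red (R : realType) (alpha psi2 rho x : R) :
  quartic alpha psi2 rho x = red_quartic alpha psi2 rho (1 + x).
Proof. by rewrite /quartic /red_quartic; ring. Qed.

(** Intermediate values between 0 and [min 2 (2 * psi2)]: the sign at 0 is negative because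
    [alpha < 1]; at the right end the product vanishes and the [alpha] part is a nonnegative
    multiple of [(psi2 - 1) ^+ 2]. *)
Lemma red_quartic_root (R : rcfType) (alpha psi2 rho : R) :
  0 <= alpha < 1 -> 0 < psi2 -> 0 < rho ->
  exists v : R, [/\ 0 < v, v < 2, v < 2 * psi2
    & red_quartic alpha psi2 rho v = 0].
Proof.
move=> /andP[a0 a1] p0 r0.
pose p : {poly R} := (8 * psi2 * rho^-1) *: 'X
  - (4 * psi2 * (1 - alpha)) *: ((2%:P - 'X) * ((2 * psi2)%:P - 'X))
  + alpha *: ((8 * psi2 * (psi2 + 1)) *: 'X - (12 * psi2) *: 'X^2 + 'X^4).
have pE y : p.[y] = red_quartic alpha psi2 rho y.
  by rewrite /p /red_quartic !hornerE.
have pos : exists2 b, [/\ 0 < b, b <= 2 & b <= 2 * psi2] & 0 < p.[b].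
  have ri : 0 < rho^-1 by rewrite invr_gt0.
  have pri : 0 < 16 * psi2 * rho^-1 by rewrite !mulr_gt0.
  have [le1|ge1] := leP 1 psi2.
    exists 2; first by split; lra.
    have -> : p.[2] = 16 * psi2 * rho^-1 + alpha * (16 * (psi2 - 1) ^+ 2).
      by rewrite pE /red_quartic; ring.
    by rewrite ltr_pwDl// mulr_ge0// mulr_ge0// sqr_ge0.
  exists (2 * psi2); first by split; lra.
  have -> : p.[2 * psi2] = 16 * psi2 * rho^-1 * psi2
      + alpha * (16 * psi2 ^+ 2 * (psi2 - 1) ^+ 2).
    by rewrite pE /red_quartic; ring.
  rewrite ltr_pwDl// ?(mulr_gt0 pri)// mulr_ge0//.
  by rewrite mulr_ge0 ?sqr_ge0// mulr_ge0 ?sqr_ge0.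
have [b [b0 b2 bp] pb] := pos.
have pn : p.[0] < 0.
  have -> : p.[0] = - (16 * psi2 ^+ 2 * (1 - alpha)).
    by rewrite pE /red_quartic; ring.
  by rewrite oppr_lt0 !mulr_gt0 ?exprn_gt0 ?subr_gt0.
have /poly_ivt : p.[0] <= 0 <= p.[b] by rewrite !ltW.
case/(_ (ltW b0)) => v /andP[v0 vb] /rootP pv.
have v0' : 0 < v.
  by rewrite lt_neqAle v0 andbT; apply: contraTneq pn => z; move: pv; rewrite -z => ->; rewrite ltxx.
have vb' : v < b.
  by rewrite lt_neqAle vb andbT; apply: contraTneq pb => <-; rewrite pv ltxx.
by exists v; rewrite -pE; split=> //; apply: lt_le_trans vb' _.
Qed.

(** * The values of [omega2] in the variable [y] *)

Section Omega2.
Variables (R : realType) (psi2 lambda : R).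
Hypotheses (psi2_gt0 : 0 < psi2) (lambda_gt0 : 0 < lambda).

Let c (m : R * R * R) := lambda * psi2 + mustar2 m.
Let a (m : R * R * R) := m.1.2 ^+ 2.

Let c_gt0 m : triples m -> 0 < c m.
Proof. by move=> tm; rewrite ltr_pwDl// mulr_gt0. Qed.

(* omega2 is the nonpositive root of c w^2 + (psi2 a - a - c) w - psi2 a, whose
   roots have product - psi2 a / c <= 0. *)
Lemma omega2P m w : triples m ->
  omega2 psi2 lambda m = w <->
  w <= 0 /\ c m * (w ^+ 2 - w) = a m * (psi2 + w - psi2 * w).
Proof.
move=> tm; have := c_gt0 tm; move: tm; case: m => -[mu0 mu1] mu2 tm.
rewrite /omega2 /c /a; set s := mustar2 _; rewrite /=.
set l := lambda * psi2 + s => l0.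
move: (mu1 ^+ 2) (sqr_ge0 mu1) => A a0.
have D0 : 0 <= 4 * psi2 * A * l by rewrite !mulr_ge0// ltW.
set D := (X in Num.sqrt X); set N := (X in - (X / _)).
pose b := psi2 * A - A - l.
have DE : D = b ^+ 2 + 4 * psi2 * A * l by rewrite /D /b /l; ring.
have NE : N = Num.sqrt D + b by rewrite /N /b /l; ring.
have D00 : 0 <= D by rewrite DE addr_ge0 ?sqr_ge0.
have l0' : l != 0 by rewrite gt_eqF.
have sD : Num.sqrt D ^+ 2 = D by rewrite sqr_sqrtr.
rewrite NE; split=> [<-|[w0 wE]].
  have bs : - b <= Num.sqrt D.
    apply: (@le_trans _ _ `|b|); first by rewrite -normrN ler_norm.
    by rewrite -sqrtr_sqr ler_wsqrtr// DE lerDl.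
  split.
    by rewrite oppr_le0 divr_ge0 ?(mulr_ge0 _ (ltW l0))// -lerBlDr sub0r.
  apply/eqP; rewrite -subr_eq0; apply/eqP.
  rewrite (_ : _ - _ = (Num.sqrt D ^+ 2 - D) / (4 * l)); last first.
    by rewrite DE /b; field.
  by rewrite sD subrr mul0r.
have wb : w * (l * w + b) = psi2 * A.
  by apply/eqP; rewrite -subr_eq0; apply/eqP; rewrite /b; move: wE; lra.
(* The slope of the quadratic at [w] is nonpositive, so [w] is its smaller root; this fixes the sign
   of the square root. *)
have lwb : 2 * l * w + b <= 0.
  have [w00|wn0] := eqVneq w 0.
    move: wb => /eqP; rewrite w00 mul0r eq_sym mulf_eq0 gt_eqF//= => /eqP A0.
    by rewrite /b A0; lra.
  have wlt : w < 0 by rewrite lt_neqAle wn0.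
  have := mulr_ge0 (ltW psi2_gt0) a0; rewrite -wb => h.
  have : l * w + b <= 0 by rewrite -(nmulr_rge0 _ wlt).
  have : l * w < 0 by rewrite pmulr_rlt0.
  lra.
have -> : Num.sqrt D = - (2 * l * w + b).
  rewrite (_ : D = (- (2 * l * w + b)) ^+ 2) ?sqrtr_sqr ?ger0_norm ?oppr_ge0//.
  rewrite DE (_ : 4 * psi2 * A * l = 4 * l * (psi2 * A)); last by ring.
  by rewrite -wb; ring.
by field.
Qed.

Lemma omega2_red m : triples m ->
  exists y : R, [/\ 0 <= y, y < 2, y < 2 * psi2
    & omega2 psi2 lambda m = - (y / (2 - y))].
Proof.
move=> tm; have := (omega2P (omega2 psi2 lambda m) tm).1 erefl.
move: (omega2 _ _ _) => w [w0 wE].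
have w1 : 0 < 1 - w by lra.
have w1' : 1 - w != 0 by rewrite gt_eqF.
(* Inverse of the substitution [w = - (y / (2 - y))]. *)
exists (- (2 * w) / (1 - w)); split.
- by rewrite divr_ge0 ?(ltW w1)//; lra.
- by rewrite ltr_pdivrMr//; lra.
- rewrite ltr_pdivrMr//.
  (* For [w < 0] the left side of [wE] is positive, which forces this factor to be positive. *)
  suff : 0 < psi2 + w - psi2 * w by lra.
  have [->|wn0] := eqVneq w 0; first by rewrite mulr0 addr0 subr0.
  have wlt : w < 0 by rewrite lt_neqAle wn0.
  have : 0 < a m * (psi2 + w - psi2 * w).
    rewrite -wE mulr_gt0 ?c_gt0// subr_gt0 (lt_trans wlt)//.
    by rewrite exprn_even_gt0.
  by rewrite !ltNge; apply: contra => h; rewrite mulr_ge0_le0 ?sqr_ge0.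
- by field; rewrite w1' (_ : _ - _ = 2) ?pnatr_eq0//; ring.
Qed.

(** Clearing [(2 - y) ^+ 2] in the quadratic equation gives, for [y = 1 + x], the relation
    describing the minimizers. *)
Lemma omega2_redP m (y : R) : triples m -> 0 <= y -> y < 2 ->
  omega2 psi2 lambda m = - (y / (2 - y)) <->
  a m * (2 * psi2 - y) * (2 - y) = 2 * c m * y.
Proof.
move=> tm y0 y2; have y2' : 0 < 2 - y by rewrite subr_gt0.
have y2n : 2 - y != 0 by rewrite gt_eqF.
apply: (iff_trans (omega2P _ tm)).
have E : a m * (psi2 - y / (2 - y) - psi2 * - (y / (2 - y)))
    - c m * ((- (y / (2 - y))) ^+ 2 - - (y / (2 - y)))
  = (a m * (2 * psi2 - y) * (2 - y) - 2 * c m * y) / (2 - y) ^+ 2 by field.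
split=> [[_ h]|h].
  move: E; rewrite h subrr => /esym/eqP.
  by rewrite mulf_eq0 invr_eq0 expf_eq0 (negPf y2n)/= orbF subr_eq0 => /eqP.
split; first by rewrite oppr_le0 divr_ge0// ltW.
by apply/esym/eqP; rewrite -subr_eq0 E h subrr mul0r.
Qed.

Lemma omega2_red_surj (y : R) : 0 <= y -> y < 2 -> y < 2 * psi2 ->
  exists2 m, triples m & omega2 psi2 lambda m = - (y / (2 - y)).
Proof.
move=> y0 y2 yp.
have d0 : 0 < 2 - y by rewrite subr_gt0.
have e0 : 0 < 2 * psi2 - y by rewrite subr_gt0.
(* Triples with [mustar2 = 0] suffice: there the relation of [omega2_redP] is solved for
   [mu1 ^+ 2 = t]. *)
pose t := 2 * (lambda * psi2) * y / ((2 * psi2 - y) * (2 - y)).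
have t0 : 0 <= t.
  by rewrite divr_ge0// mulr_ge0// ?ltW// !mulr_gt0.
have st : Num.sqrt t ^+ 2 = t by rewrite sqr_sqrtr.
have s0 : mustar2 (0, Num.sqrt t, t) = 0 by rewrite /= st expr0n/= subr0 subrr.
have tm : triples (0, Num.sqrt t, t) by rewrite /triples /mkset s0.
exists (0, Num.sqrt t, t) => //; apply/(omega2_redP tm y0 y2).
rewrite /a /c s0 addr0 /= st /t; field.
by rewrite !gt_eqF.
Qed.

End Omega2.

(** * Reduction of the objective, and the set of minimizers *)

Lemma objective_red (R : realType) (alpha psi2 lambda F1 Fs tau y : R) m :
  0 < psi2 -> 0 < Fs ^+ 2 + tau ^+ 2 -> 0 <= y -> y < 2 -> y < 2 * psi2 ->
  omega2 psi2 lambda m = - (y / (2 - y)) ->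
  objective alpha psi2 lambda F1 Fs tau m
  = (Fs ^+ 2 + tau ^+ 2)
    * red_obj alpha psi2 (F1 ^+ 2 / (Fs ^+ 2 + tau ^+ 2)) y
    + (1 - alpha) * Fs ^+ 2.
Proof.
move=> p0 N0 y0 y2 yp wE.
have y2n : 2 - y != 0 by rewrite subr_eq0 gt_eqF.
have := red_den_gt0 y0 y2 yp.
rewrite /red_obj /objective /test_error /sensitivity wE /red_num /red_den => D0.
have D0' : 4 * psi2 - y ^+ 2 != 0 by rewrite gt_eqF.
have N0' : Fs ^+ 2 + tau ^+ 2 != 0 by rewrite gt_eqF.
set w := - (y / (2 - y)).
(* Both denominators equal [(w - 1) * (psi2 * (w - 1) ^+ 2 - w ^+ 2)], and
   [w - 1 = - 2 / (2 - y)]. *)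
rewrite (_ : (psi2 - 1) * w ^+ 3 + (1 - 3 * psi2) * w ^+ 2 + 3 * psi2 * w - psi2
  = - 2 * (4 * psi2 - y ^+ 2) / (2 - y) ^+ 3); last by rewrite /w; field.
rewrite (_ : (-1 + w) * (psi2 - 2 * w * psi2 + w ^+ 2 * (-1 + psi2))
  = - 2 * (4 * psi2 - y ^+ 2) / (2 - y) ^+ 3); last by rewrite /w; field.
rewrite /w; field.
by rewrite N0' D0' y2n.
Qed.

Theorem theorem10 (R : realType) (alpha psi2 lambda F1 Fs tau rho : R)
  (halpha : 0 <= alpha < 1) (hpsi2 : 0 < psi2) (hlambda : 0 < lambda)
  (hF1 : 0 < F1) (hFs : 0 <= Fs) (htau : 0 <= tau)
  (hnoise : 0 < Fs ^+ 2 + tau ^+ 2)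
  (hrho : rho = F1 ^+ 2 / (Fs ^+ 2 + tau ^+ 2)) :
  exists x : R,
    unique (fun y : R => -1 < y < Num.min 1 (-1 + 2 * psi2)
                         /\ quartic alpha psi2 rho y = 0) x
    /\ minimizers alpha psi2 lambda F1 Fs tau
       = [set m | triples m /\
           let: (_, mu1, _) := m in
           mu1 ^+ 2 * (-1 + 2 * psi2 - x) * (-1 + x)
           = - (2 * (mustar2 m + lambda * psi2) * (1 + x))]%classic.
Proof.
have r0 : 0 < rho by rewrite hrho divr_gt0// exprn_gt0.
have [a0 _] := andP halpha.
have [v [v0 v2 vp Hv]] := red_quartic_root halpha hpsi2 r0.
have vmin := red_obj_min a0 hpsi2 r0 v0 v2 vp Hv.
have objE := objective_red alpha F1 hpsi2 hnoise; rewrite -hrho in objE.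
have vx : v = 1 + (v - 1) by ring.
exists (v - 1); split.
  split=> [|y [/andP[y1]]].
    rewrite quartic_red -vx; split=> //.
    by rewrite lt_min; apply/and3P; split; lra.
  rewrite lt_min quartic_red => /andP[y1' yp] Hy.
  have u0 : 0 < 1 + y by lra.
  have u2 : 1 + y < 2 by lra.
  have up : 1 + y < 2 * psi2 by lra.
  (* Two distinct roots would each have a strictly smaller value of [red_obj] than the other. *)
  have [->|ne] := eqVneq v (1 + y); first by ring.
  have := vmin _ (ltW u0) u2 up; rewrite eq_sym => /(_ ne).
  have := red_obj_min a0 hpsi2 r0 u0 u2 up Hy (ltW v0) v2 vp ne.
  by move=> /lt_trans h /h; rewrite ltxx.
have relE m : triples m ->
    (let: (_, mu1, _) := m in
      mu1 ^+ 2 * (-1 + 2 * psi2 - (v - 1)) * (-1 + (v - 1))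
      = - (2 * (mustar2 m + lambda * psi2) * (1 + (v - 1))))
    <-> omega2 psi2 lambda m = - (v / (2 - v)).
  move=> tm; apply: iff_trans (iff_sym (omega2_redP hpsi2 hlambda tm (ltW v0) v2)).
  case: m tm => -[mu0 mu1] mu2 tm; set s := mustar2 _; rewrite /= -/s.
  by split=> h; lra.
apply/seteqP; split=> m [tm].
  move=> mmin; split=> //; apply/relE => //.
  have [y [y0 y2 yp yE]] := omega2_red hpsi2 hlambda tm.
  (* A triple attaining the optimal value [v] is the competitor that forces [y = v]. *)
  have [m' tm' mE'] := omega2_red_surj hpsi2 hlambda (ltW v0) v2 vp.
  have := mmin _ tm'.
  rewrite (objE _ _ _ y0 y2 yp yE) (objE _ _ _ (ltW v0) v2 vp mE').
  rewrite lerD2r ler_pM2l// leNgt.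
  have [<- //|yv] := eqVneq y v.
  by rewrite vmin.
move=> /(relE _ tm) mE; split=> // m' tm'.
have [y [y0 y2 yp yE]] := omega2_red hpsi2 hlambda tm'.
rewrite (objE _ _ _ y0 y2 yp yE) (objE _ _ _ (ltW v0) v2 vp mE).
rewrite lerD2r ler_pM2l//.
by have [->//|yv] := eqVneq y v; rewrite ltW// vmin.
Qed.
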